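(* Let $k,n\in\mathbb{N}$ satisfy $\gcd(k,n)=1$. Then the function $f:\mathbb{F}_{2^n}\to\mathbb{F}_{2^n}$ given by $f(x)=x^{2^{2k}+2^k+1}$ has second-order zero differential uniformity $\nabla_f\leq 4$.
   Context: $\mathbb{N}=\{1,2,3,\dots\}$; $\mathbb{F}_{2^n}$ is the finite field with $2^n$ elements. For $f:\mathbb{F}_{2^n}\to\mathbb{F}_{2^n}$ and $a,b\in\mathbb{F}_{2^n}$, let $$\nabla_f(a,b)=\left|\{x\in\mathbb{F}_{2^n} : f(x+a+b)-f(x+a)-f(x+b)+f(x)=0\}\right|.$$ The second-order zero differential uniformity of $f$ is $\nabla_f=\max\{\nabla_f(a,b) : a,b\in\mathbb{F}_{2^n},\ a\neq b,\ a\neq 0,\ b\neq 0\}$. *)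

(* Defs.v *)
From mathcomp Require Import all_boot all_algebra all_field.

Set Implicit Arguments.
Unset Strict Implicit.
Unset Printing Implicit Defensive.

Import GRing.Theory.
Local Open Scope ring_scope.

Definition so_zero_count (F : finFieldType) (f : F -> F) (a b : F) : nat :=
  #|[set x : F | f (x + a + b) - f (x + a) - f (x + b) + f x == 0]|.

(* Over the two-element field there is no admissible pair (a, b), and the
   maximum over the empty family is 0. *)
Definition so_zero_diff_uniformity (F : finFieldType) (f : F -> F) : nat :=
  \max_(ab : F * F | [&& ab.1 != ab.2, ab.1 != 0 & ab.2 != 0])
    so_zero_count f ab.1 ab.2.

(* Main.v *)
Require Import Defs.
From mathcomp Require Import all_boot all_algebra all_field.
From mathcomp Require Import ring.

(** With s(x) = x^(2^k) we have f(x) = x s(x) s(s(x)), a trilinear form on the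
    diagonal, so the second-order derivative in directions a, b is affine in x.
    Its linear part sends z to the permanent of the rows (v, s(v), s(s(v))) for
    v = a, b, z; in characteristic 2 this is the Moore determinant of a, b, z,
    which vanishes only if z lies in the span of a and b over the fixed field of
    s. As gcd(k, n) = 1 that field is F_2, so the zeros of the derivative lie in
    a translate of {0, a, b, a + b}. *)

Import GRing.Theory.
Local Open Scope ring_scope.

Definition moore3 (F : pzRingType) (s : F -> F) (a b z : F) : F :=
  a * (s b * s (s z) - s (s b) * s z) - s a * (b * s (s z) - s (s b) * z)
  + s (s a) * (b * s z - s b * z).

(** With [v = b / a] and [u = z / a], the determinant is a nonzero multiple of the 2 by 2 Moore
    determinant of [s v - v] and [s u - u]. Its vanishing makes the ratio of these two elements a
    fixed point of [s]. *)
Lemma moore3_eq0_span (F : fieldType) (s : {rmorphism F -> F}) (a b z : F) :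
    a != 0 -> s (b / a) != b / a -> moore3 F s a b z = 0 ->
  exists c d, [/\ s c = c, s d = d & z = c * a + d * b].
Proof.
move=> a0; set v := b / a; set u := z / a => sv.
have -> : b = v * a by rewrite divfK.
have -> : z = u * a by rewrite divfK.
clearbody u v; rewrite -subr_eq0 in sv.
have -> : moore3 F s a (v * a) (u * a)
    = (a * s a * s (s a)) * ((s v - v) * s (s u - u) - (s u - u) * s (s v - v)).
  by rewrite /moore3 !(rmorphM, rmorphB); ring.
move/eqP; rewrite !mulf_eq0 !fmorph_eq0 (negPf a0) /= subr_eq0 => /eqP eqUV.
have sd : s ((s u - u) / (s v - v)) = (s u - u) / (s v - v).
  rewrite fmorph_div; apply/eqP; rewrite eqr_div ?fmorph_eq0 //.
  by rewrite mulrC eqUV.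
have defU : s u = u + (s u - u) / (s v - v) * (s v - v) by rewrite divfK // subrKC.
move: (_ / _) sd defU => d sd defU.
(* As [s u - u = d * (s v - v)] with [d] fixed, [u - d * v] is fixed too. *)
exists (u - d * v), d; split=> //; last by ring.
by rewrite rmorphB rmorphM sd defU; ring.
Qed.

Lemma expn_pchar_rmorphism (R : comNzRingType) (p k : nat) :
  p \in [pchar R] -> exists s : {rmorphism R -> R}, forall x, s x = x ^+ (p ^ k).
Proof.
move=> chR; elim: k => [|k [s sE]].
  by exists idfun => x; rewrite expn0 expr1.
exists (pFrobenius_aut chR \o s) => x /=.
by rewrite pFrobenius_autE sE -exprM expnSr.
Qed.

Lemma expr_iter_fixed (R : pzSemiRingType) (x : R) (m j : nat) :
  x ^+ m = x -> x ^+ (m ^ j) = x.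
Proof. by move=> xm; elim: j => [|j IH]; rewrite ?expr1 // expnS exprM xm. Qed.

(** Bezout gives [u * k = v * n + 1], so raising [x] to the power [p ^ (u * k)] yields both [x] and
    [x ^+ p]. *)
Lemma expn_coprime_fixed (R : pzSemiRingType) (x : R) (p k n : nat) :
    (0 < k)%N -> coprime k n -> x ^+ (p ^ k) = x -> x ^+ (p ^ n) = x ->
  x ^+ p = x.
Proof.
move=> k0 /eqP cokn xk xn; case: (egcdnP n k0) => u v eq_uv _.
have := expr_iter_fixed R x _ u xk.
rewrite -expnM mulnC eq_uv cokn expnD expn1 exprM mulnC expnM.
by rewrite (expr_iter_fixed _ _ _ _ xn).
Qed.

Lemma so_diff_moore3 (F : comPzRingType) (s : {rmorphism F -> F}) (a b x y : F) :
    2%:R = 0 :> F ->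
  let f t := t * s t * s (s t) in
  let D t := f (t + a + b) - f (t + a) - f (t + b) + f t in
  D x - D y = moore3 F s a b (x - y).
Proof.
move=> two0 f D; rewrite /D /f /moore3.
apply/eqP; rewrite -subr_eq0; apply/eqP.
rewrite !(rmorphD, rmorphB) /=.
(* Permanent minus determinant is twice the sum of the terms from odd permutations. *)
transitivity (2%:R * (a * s (s b) * (s x - s y) + s a * b * (s (s x) - s (s y))
                + s (s a) * s b * (x - y))); first by ring.
by rewrite two0 mul0r.
Qed.

Lemma so_zero_count_le4 (F : finFieldType) (s : {rmorphism F -> F}) (f : F -> F)
    (a b : F) :
    2%:R = 0 :> F -> (forall x, s x = x -> x = 0 \/ x = 1) ->
    (forall x, f x = x * s x * s (s x)) ->
  a != b -> a != 0 -> b != 0 -> (so_zero_count f a b <= 4)%N.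
Proof.
move=> two0 fix_s fE ab a0 b0; rewrite /so_zero_count; set S := [set x | _].
have [->|[y yS]] := set_0Vmem S; first by rewrite cards0.
pose T := [:: y; y + b; y + a; y + (a + b)].
suff /subset_leq_card/leq_trans : S \subset T by apply; exact: card_size.
apply/subsetP=> x; move: yS; rewrite !inE !fE => /eqP Dy /eqP Dx.
have := so_diff_moore3 F s a b x y two0; rewrite /= Dx Dy subrr => /esym det0.
(* Were [b / a] fixed, it would be 0 or 1, forcing [b = 0] or [a = b]. *)
have sba : s (b / a) != b / a.
  apply/eqP => /fix_s[] /eqP; first by rewrite mulf_eq0 invr_eq0 (negPf a0) (negPf b0).
  by rewrite -subr_eq0 -(divff a0) -mulrBl mulf_eq0 invr_eq0 (negPf a0) subr_eq0
    eq_sym (negPf ab).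
have [c [d [/fix_s sc /fix_s sd xy]]] := moore3_eq0_span F s a b _ a0 sba det0.
have {xy} -> : x = y + (c * a + d * b) by rewrite -xy subrKC.
by case: sc sd => -> [] ->; rewrite ?(mul0r, mul1r, add0r, addr0) eqxx ?orbT.
Qed.

Local Close Scope ring_scope.

Theorem corollary3p4 (k n : nat) (F : finFieldType)
  (hk : 0 < k) (hn : 0 < n) (hkn : gcdn k n = 1) (hF : #|F| = 2 ^ n) :
  so_zero_diff_uniformity
    (fun x : F => (x ^+ (2 ^ (2 * k) + 2 ^ k + 1))%R) <= 4.
Proof.
have ch2 : 2 \in [pchar F]%R by apply: (card_finPcharP hF).
have [s sE] := expn_pchar_rmorphism F 2 k ch2.
apply/bigmax_leqP => -[a b] /= /and3P[ab a0 b0].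
apply: (so_zero_count_le4 F s) => //.
- exact: pcharf0 ch2.
- move=> x; rewrite sE => xk.
  (* Besides [xk], every element satisfies [x ^+ (2 ^ n) = x] because the field has [2 ^ n]
     elements. *)
  have : (x ^+ 2 = x)%R.
    by apply: (expn_coprime_fixed _ x 2 k n) => //; [apply/eqP | rewrite -hF expf_card].
  move/eqP; rewrite -subr_eq0 -[X in (_ - X)%R]mulr1 expr2 -mulrBr mulf_eq0 subr_eq0.
  by case/orP=> /eqP; [left | right].
- move=> x; rewrite !sE -exprM -expnD addnn -mul2n -exprS -exprD.
  by congr (_ ^+ _)%R; rewrite addn1 addSn addnC.
Qed.
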